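(* Every pro-$\ast$-reversible ring is reversible.
   Context: All rings are associative with unity. A $\ast$-ring is a ring $R$ equipped with an involution $\ast$, i.e. a map $\ast:R\to R$ with $(x+y)^{\ast}=x^{\ast}+y^{\ast}$, $(xy)^{\ast}=y^{\ast}x^{\ast}$ and $(x^{\ast})^{\ast}=x$ for all $x,y\in R$. $P(R)$ is the set of projections of $R$, i.e. elements $p$ with $p=p^{2}=p^{\ast}$. A $\ast$-ring $R$ is pro-$\ast$-reversible if for all $a,b\in R$, $ab\in P(R)$ implies $b^{\ast}a\in P(R)$. A ring $R$ is reversible if for all $a,b\in R$, $ab=0$ implies $ba=0$. *)

(* Defs.v *)
From mathcomp Require Import all_boot all_algebra.

Set Implicit Arguments.
Unset Strict Implicit.
Unset Printing Implicit Defensive.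

Import GRing.Theory.
Local Open Scope ring_scope.

(* Rings are pzRingType: associative and unital, not necessarily commutative,
   with the zero ring allowed. *)

Definition ring_involution (R : pzRingType) (star : R -> R) : Prop :=
  [/\ {morph star : x y / x + y},
      forall x y : R, star (x * y) = star y * star x
    & involutive star].

Definition is_projection (R : pzRingType) (star : R -> R) (p : R) : Prop :=
  p = p ^+ 2 /\ p = star p.

Definition pro_star_reversible (R : pzRingType) (star : R -> R) : Prop :=
  forall a b : R,
    is_projection star (a * b) -> is_projection star (star b * a).

Definition reversible (R : pzRingType) : Prop :=
  forall a b : R, a * b = 0 -> b * a = 0.

(* Main.v *)
Require Import Defs.
From mathcomp Require Import all_boot all_algebra.

Import GRing.Theory.
Local Open Scope ring_scope.

(** Suppose [a * b = 0].  Then [a * (b * r) = 0] for every [r], and [0] is a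
    projection, so the hypothesis makes every left multiple of
    [p = star b * a] a projection.  This is very restrictive: such a [p] is
    central, and [x * p = p * star x] for all [x]
    ([all_multiples_projection_central], [all_multiples_projection_twist]).
    Hence
      [p = p * p = star b * (a * p) = star b * (p * star a)
         = p * star (a * b) = 0],
    that is, [a * b = 0] implies [star b * a = 0] ([zero_product_star]).
    Using this implication twice gives [star a * star b = 0], whose image
    under the involution is [b * a = 0]. *)

Lemma involution0 (R : pzRingType) (star : R -> R) :
  ring_involution star -> star 0 = 0.
Proof.
by case=> starD _ _; apply: (addrI (star 0)); rewrite -starD !addr0.
Qed.

Lemma projection0 (R : pzRingType) (star : R -> R) :
  ring_involution star -> is_projection star 0.
Proof. by move=> star_inv; split; rewrite ?involution0 // expr2 mul0r. Qed.

(** Both [p] and [t * p] are self-adjoint. *)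
Lemma all_multiples_projection_twist (R : pzRingType) (star : R -> R) (p : R) :
    ring_involution star -> (forall t, is_projection star (t * p)) ->
  forall t, t * p = p * star t.
Proof.
case=> _ starM _ projM t.
have [_ p_sa] := projM 1; rewrite mul1r in p_sa.
by have [_ ->] := projM t; rewrite starM -p_sa.
Qed.

(** Two twists cancel: [p * t = p * (p * t) = p * (star t * p)
    = (p * star t) * p = (t * p) * p = t * p]. *)
Lemma all_multiples_projection_central (R : pzRingType) (star : R -> R) (p : R) :
    ring_involution star -> (forall t, is_projection star (t * p)) ->
  forall t, t * p = p * t.
Proof.
move=> star_inv projM t.
have twist := all_multiples_projection_twist _ _ _ star_inv projM.
have [_ _ starK] := star_inv.
have [p_idem _] := projM 1; rewrite mul1r expr2 in p_idem.
rewrite [in RHS]p_idem -mulrA -[X in p * (p * X)]starK -twist.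
by rewrite mulrA -twist -mulrA -p_idem.
Qed.

Lemma zero_product_star (R : pzRingType) (star : R -> R) (a b : R) :
    ring_involution star -> pro_star_reversible star ->
  a * b = 0 -> star b * a = 0.
Proof.
move=> star_inv rev ab0.
have [_ starM starK] := star_inv.
have projM t : is_projection star (t * (star b * a)).
  (* [t * star b] is the adjoint of [b * star t]. *)
  rewrite mulrA -[t]starK -starM; apply: rev.
  by rewrite mulrA ab0 mul0r; apply: projection0.
have twist := all_multiples_projection_twist _ _ _ star_inv projM.
have central := all_multiples_projection_central _ _ _ star_inv projM.
have [p_idem _] := projM 1; rewrite mul1r expr2 in p_idem.
rewrite p_idem -mulrA twist mulrA central -mulrA -starM ab0.
by rewrite involution0 // mulr0.
Qed.

Theorem lemma3p3 (R : pzRingType) (star : R -> R)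
    (star_inv : ring_involution star)
    (R_pro_star_rev : pro_star_reversible star) :
  reversible R.
Proof.
move=> a b ab0; have [_ starM starK] := star_inv.
have star_ab0 : star a * star b = 0.
  by do 2!apply: (zero_product_star _ star _ _ star_inv R_pro_star_rev).
by rewrite -[LHS]starK starM star_ab0 involution0.
Qed.
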